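(* Let $X=\{(x,y)\in\mathbb{Z}^2 \mid y>0,\ -y \leq x \leq y\}$, with the metric inherited from $\mathbb{Z}^2$. Let $A = \{(x, x) \mid x\in \mathbb{Z}, x > 0\}$ and $B = \{(-x, x) \mid x \in \mathbb{Z}, x > 0\}$. Let $\mathscr{L}$ be the set of all uniformly locally finite families $\mathcal{V}$ of subsets of $X$ such that for any uniformly bounded cover $\mathcal{U}$ in the metric ls-structure on $X$, the family of those $V\in \mathcal{V}$ intersecting $\mathrm{st}(A\cup B,\mathcal{U})$ is uniformly bounded in the metric ls-structure on $X$. Then: (1) $\mathscr{L}$ is a uniformly locally finite ls-structure on $X$, and all families uniformly bounded with respect to the metric ls-structure are members of $\mathscr{L}$; (2) $A$ and $B$ are coarsely separated in $(X, \mathscr{L})$; (3) there is no function $f: X \rightarrow [0,1]$, slowly oscillating with respect to $\mathscr{L}$, such that $f(A) = \{0\}$ and $f(B) = \{1\}$. In particular, $(X,\mathscr{L})$ (with the discrete topology) is not hls-normal.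
   Context: For $B\subseteq X$ and a family $\mathcal{U}$ of subsets of $X$, $\mathrm{st}(B,\mathcal{U})$ is the union of the elements of $\mathcal{U}$ meeting $B$; for a family $\mathcal{B}$, $\mathrm{st}(\mathcal{B},\mathcal{U})=\{\mathrm{st}(B,\mathcal{U})\mid B\in\mathcal{B}\}$. A large scale structure (ls-structure) on a set $X$ is a nonempty collection $\mathcal{L}$ of families of subsets of $X$ (the uniformly bounded families) such that: (i) if $\mathcal{B}_1\in\mathcal{L}$ and each element of $\mathcal{B}_2$ having more than one point is contained in some element of $\mathcal{B}_1$, then $\mathcal{B}_2\in\mathcal{L}$; (ii) $\mathcal{B}_1,\mathcal{B}_2\in\mathcal{L}$ implies $\mathrm{st}(\mathcal{B}_1,\mathcal{B}_2)\in\mathcal{L}$. The metric ls-structure of a metric space consists of all families refining $\{B(x,R)\mid x\in X\}$ for some $R>0$ (for $X\subseteq\mathbb{Z}^2$ one may use the $\ell_1$-metric; the Euclidean metric gives the same ls-structure). A family $\mathcal{U}$ of subsets of $X$ is uniformly locally finite if there is a natural number $m$ with $\mathrm{card}(\mathrm{st}(\{x\},\mathcal{U}))\leq m$ for all $x\in X$. An ls-structure is uniformly locally finite if every uniformly bounded cover is uniformly locally finite. A subset is bounded if it is an element of some uniformly bounded cover. The coarse component of a point $x$ is the union of all bounded sets containing $x$. A subset is weakly bounded if its intersection with every coarse component is bounded. A map $f:X\to M$ to a metric space is slowly oscillating if for every uniformly bounded family $\mathcal{U}$ and every $\varepsilon>0$ there is a weakly bounded set $K$ such that $\mathrm{diam}(f(U))<\varepsilon$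 for every $U\in\mathcal{U}$ with $U\cap K=\varnothing$. Subsets $A,B$ are coarsely separated if $\mathrm{st}(A,\mathcal{U})\cap\mathrm{st}(B,\mathcal{U})$ is weakly bounded for every uniformly bounded family $\mathcal{U}$. $N$ is a coarse neighbourhood of $A$ if $A\subseteq N$ and for every uniformly bounded cover $\mathcal{U}$, $\mathrm{st}(A,\mathcal{U})\subseteq N\cup K$ for some weakly bounded $K$. An ls-space with the discrete topology is hls-normal exactly when for every $A$ and every coarse neighbourhood $N$ of $A$ there is $V$ such that $V$ is a coarse neighbourhood of $A$ and $N$ is a coarse neighbourhood of $V$. *)

(* Defs.v *)
From HB Require Import structures.
From mathcomp Require Import all_boot all_order all_algebra.
From mathcomp Require Import all_classical all_reals all_analysis.

Set Implicit Arguments.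
Unset Strict Implicit.
Unset Printing Implicit Defensive.

Import Order.TTheory GRing.Theory Num.Theory.
Import numFieldNormedType.Exports.

Local Open Scope classical_set_scope.
Local Open Scope ring_scope.

Section LargeScale.
Context {X : Type}.
Implicit Types (A B K N V : set X) (U FF : set (set X)) (L : set (set (set X))).

Definition star B U : set X := \bigcup_(V in [set V | U V /\ V `&` B !=set0]) V.

Definition star_family FF U : set (set X) :=
  [set star B U | B in FF].

Definition is_cover U : Prop := \bigcup_(V in U) V = [set: X].

Definition ls_structure L : Prop :=
  [/\ L !=set0,
      forall F1 F2, L F1 ->
        (forall B, F2 B -> (exists x y, [/\ B x, B y & x <> y]) ->
           exists2 C, F1 C & B `<=` C) ->
        L F2
    & forall F1 F2, L F1 -> L F2 -> L (star_family F1 F2)].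

Definition uniformly_locally_finite U : Prop :=
  exists m : nat, forall x, (star [set x] U #<= `I_m)%card.

Definition ls_uniformly_locally_finite L : Prop :=
  forall U, L U -> is_cover U -> uniformly_locally_finite U.

Definition ls_bounded L B : Prop := exists U, [/\ L U, is_cover U & U B].

Definition coarse_component L (x : X) : set X :=
  \bigcup_(B in [set B | ls_bounded L B /\ B x]) B.

Definition weakly_bounded L K : Prop :=
  forall x, ls_bounded L (K `&` coarse_component L x).

Definition coarsely_separated L A B : Prop :=
  forall U, L U -> weakly_bounded L (star A U `&` star B U).

Definition coarse_neighbourhood L A N : Prop :=
  A `<=` N /\
  forall U, L U -> is_cover U ->
    exists2 K, weakly_bounded L K & star A U `<=` N `|` K.

(* hls-normality of an ls-space endowed with the discrete topology *)
Definition hls_normal_discrete L : Prop :=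
  forall A N, coarse_neighbourhood L A N ->
    exists V, coarse_neighbourhood L A V /\ coarse_neighbourhood L V N.

End LargeScale.

Section Metric.
Context {R : realType}.

Definition metric_ls (T : metricType R) : set (set (set T)) :=
  [set U | exists2 r : R, 0 < r &
     forall B, U B -> exists x : T, B `<=` ball x r].

(* 0 is adjoined so that the empty set has diameter 0 rather than -oo *)
Definition diam {M : metricType R} (S : set M) : \bar R :=
  ereal_sup (0%E |` [set (mdist x y)%:E | x in S & y in S]).

Definition slowly_oscillating {X : Type} {M : metricType R}
    (L : set (set (set X))) (f : X -> M) : Prop :=
  forall (U : set (set X)) (e : R), L U -> 0 < e ->
    exists2 K, weakly_bounded L K &
      forall V, U V -> V `&` K = set0 -> (diam (f @` V) < e%:E)%E.

End Metric.

(* X = {(x, y) in Z^2 | y > 0, -y <= x <= y}. The parameter R is the field in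
   which distances take their values; it is there so that the type can carry
   a [metricType R] structure. *)
Definition cone (R : realType) : Type :=
  {p : int * int | (0 < p.2) && (- p.2 <= p.1 <= p.2)}.

HB.instance Definition _ (R : realType) := Choice.on (cone R).

Section Cone.
Context {R : realType}.
Implicit Types p q : cone R.

(* the l^1 metric of Z^2; the Euclidean one gives the same ls-structure *)
Definition cone_dist p q : R :=
  (`|(val p).1 - (val q).1| + `|(val p).2 - (val q).2|)%:~R.

Lemma cone_distxx p : cone_dist p p = 0.
Proof. by rewrite /cone_dist !subrr. Qed.

Lemma cone_dist_positivity p q : cone_dist p q = 0 -> p = q.
Proof.
move=> /eqP; rewrite /cone_dist intr_eq0 paddr_eq0 ?normr_ge0//.
rewrite !normr_eq0 !subr_eq0 => /andP[/eqP e1 /eqP e2].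
by apply: val_inj; move: (val p) (val q) e1 e2 => [? ?] [? ?] /= -> ->.
Qed.

Lemma cone_dist_sym p q : cone_dist p q = cone_dist q p.
Proof.
by rewrite /cone_dist distrC [X in _ + X]distrC.
Qed.

Lemma cone_dist_triangle q p r :
  cone_dist p r <= cone_dist p q + cone_dist q r.
Proof.
rewrite /cone_dist -intrD ler_int addrACA.
by apply: lerD; exact: ler_distD.
Qed.

HB.instance Definition _ := isMetric.Build R (cone R)
  cone_distxx cone_dist_positivity cone_dist_sym cone_dist_triangle.

Definition rayA : set (cone R) :=
  [set p | exists2 x : int, 0 < x & val p = (x, x)].

Definition rayB : set (cone R) :=
  [set p | exists2 x : int, 0 < x & val p = (- x, x)].

Definition cone_ls : set (set (set (cone R))) :=
  [set VV | uniformly_locally_finite VV /\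
     forall U, metric_ls U -> is_cover U ->
       metric_ls [set V | VV V /\ V `&` star (rayA `|` rayB) U !=set0]].

End Cone.

Arguments rayA R : clear implicits.
Arguments rayB R : clear implicits.
Arguments cone_ls R : clear implicits.

(* Main.v *)
(* Every uniformly bounded family of metric balls lies in L, so a set that is
   eventually close to A (a slowly oscillating f near 0, or a coarse
   neighbourhood of A) contains points p arbitrarily far from A and B, and
   likewise a set eventually close to B contains such points q. A matching of
   pairwise distinct p_k, q_k whose distances to A and B tend to infinity is
   itself a member of L, because only finitely many pairs come near A or B;
   weakly bounded sets are finite, so some pair avoids any prescribed one.
   Hence f cannot oscillate slowly, and in a chain A < V < W < X \ B of coarse
   neighbourhoods W cannot contain the star of V along the pairs with p_k in V
   and q_k outside W. *)
Require Import Defs.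
From mathcomp Require Import all_boot all_order all_algebra.
From mathcomp Require Import all_classical all_reals all_analysis.
From mathcomp Require Import zify lra.
Import Order.TTheory GRing.Theory Num.Theory.
Import numFieldNormedType.Exports.
Set Implicit Arguments.
Unset Strict Implicit.
Unset Printing Implicit Defensive.
Local Open Scope classical_set_scope.
Local Open Scope ring_scope.

(** * Uniform local finiteness through finite lists *)

Lemma card_le_seqP (T : choiceType) (A : set T) (m : nat) :
  (A #<= `I_m)%card <-> exists2 s : seq T, (size s <= m)%N & A `<=` [set` s].
Proof.
split=> [Am | [s sm As]]; last first.
  apply: (card_le_trans (subset_card_le As)).
  apply: (card_le_trans (B := `I_(size s))); last by rewrite card_le_II.
  (* Values in [option T] give a default [None], so that the enumeration makes sense even when [T]
     is empty. *)
  have [g gs] : exists g : nat -> option T,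
      [set` s] `<=` some @^-1` (g @` `I_(size s)).
    exists (fun i => nth None (map some s) i) => x /= xs.
    exists (index x s); first by rewrite /= index_mem.
    by rewrite (nth_map x) ?index_mem// nth_index.
  apply/ocard_geP; apply/surjPex; exists g.
  by move=> _ [x xs <-]; exact: gs.
have /ocard_geP/surjPex [g gA] := Am.
exists (pmap g (iota 0 m)).
  by rewrite size_pmap (leq_trans (count_size _ _))// size_iota.
move=> x Ax; have [i /= im gi] := gA (Some x) (ex_intro2 _ _ x Ax erefl).
by rewrite /= mem_pmap -gi map_f// mem_iota.
Qed.

Section LocallyFinite.
Variable T : choiceType.
Implicit Types (U F : set (set T)).

Lemma star1P (x y : T) U :
  star [set x] U y <-> exists V, [/\ U V, V x & V y].
Proof.
split=> [[V [UV [z [Vz zx]]] Vy]|[V [UV Vx Vy]]].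
  by move: zx Vz => /= -> Vx; exists V.
by exists V => //; split => //; exists x.
Qed.

(** Choosing a list for every point at once turns bounds on iterated stars into bounds on the size
    of concatenated lists. *)
Lemma ulfP U : uniformly_locally_finite U <->
  exists m (l : T -> seq T), forall x,
    (size (l x) <= m)%N /\ star [set x] U `<=` [set` l x].
Proof.
split=> [[m mU]|[m [l lU]]]; exists m; last first.
  by move=> x; apply/card_le_seqP; have [] := lU x; exists (l x).
have {}mU x : exists s : seq T, (size s <= m)%N /\ star [set x] U `<=` [set` s].
  by have /card_le_seqP[s sm sU] := mU x; exists s.
by have [l lU] := choice mU; exists l.
Qed.

(** The point [x] itself joins its list because a singleton of [F2] may lie in no element of [F1];
    hence the bound [m.+1]. *)
Lemma ulf_refine F1 F2 : uniformly_locally_finite F1 ->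
  (forall B, F2 B ->
     (exists2 C, F1 C & B `<=` C) \/ forall x y, B x -> B y -> x = y) ->
  uniformly_locally_finite F2.
Proof.
move=> /ulfP[m [l lF]] F21; apply/ulfP; exists m.+1, (fun x => x :: l x) => x.
have [lm lx] := lF x; split=> // y /star1P[B [/F21[[C FC BC]|Bs] Bx By]].
  rewrite /mkset inE; apply/orP; right; apply: lx; apply/star1P.
  by exists C; split => //; exact: BC.
by rewrite /mkset (Bs _ _ By Bx) mem_head.
Qed.

Lemma size_flatten_map_le (l : T -> seq T) k s :
  (forall y, size (l y) <= k)%N -> (size (flatten (map l s)) <= size s * k)%N.
Proof. by move=> lk; elim: s => //= y s IH; rewrite size_cat mulSn leq_add. Qed.

(** Two points [x], [y] of one star are joined by a chain: [x] and [b] in [V], [b] and [c] in [B],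
    [c] and [y] in [W], with [V], [W] in [F2] and [B] in [F1]. Each link costs one list. *)
Lemma ulf_star F1 F2 : uniformly_locally_finite F1 ->
  uniformly_locally_finite F2 -> uniformly_locally_finite (star_family F1 F2).
Proof.
move=> /ulfP[m1 [n1 lF1]] /ulfP[m2 [n2 lF2]]; apply/ulfP.
pose l x := flatten [seq flatten [seq n2 z | z <- n1 y] | y <- n2 x].
exists (m2 * (m1 * m2))%N, l => x; split.
  apply: leq_trans (size_flatten_map_le (k := (m1 * m2)%N) _ _) _ => [y|].
    apply: leq_trans (size_flatten_map_le (k := m2) _ _) _ => [z|].
      by have [] := lF2 z.
    by rewrite leq_mul2r (lF1 y).1 orbT.
  by rewrite leq_mul2r (lF2 x).1 orbT.
move=> y /star1P[_ [[B FB <-] [V [FV [b [Vb Bb]]] Vx] [W [FW [c [Wc Bc]]] Wy]]].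
apply/flatten_mapP; exists b; first by apply: (lF2 x).2; apply/star1P; exists V.
apply/flatten_mapP; exists c; first by apply: (lF1 b).2; apply/star1P; exists B.
by apply: (lF2 c).2; apply/star1P; exists W.
Qed.

End LocallyFinite.

(** * Distances, heights and depths in the cone *)

Section Cone.
Variable R : realType.
Implicit Types p q : cone R.

Definition l1 p q : nat :=
  (`|(val p).1 - (val q).1| + `|(val p).2 - (val q).2|)%N.

(** As the first coordinate is at most the second in absolute value, this number controls the whole
    point: sets of bounded height are finite. *)
Definition height p : nat := `|(val p).2|%N.

(* The l^1-distance to the union of the two rays. *)
Definition depth p : nat := `|(val p).2 - `|(val p).1| |%N.

Lemma mdist_l1 p q : mdist p q = (l1 p q)%:R.
Proof. by rewrite /mdist /= /cone_dist /l1 -!abszE -PoszD pmulrn. Qed.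

Lemma l1xx p : l1 p p = 0%N.
Proof. by rewrite /l1; lia. Qed.

Lemma l1C p q : l1 p q = l1 q p.
Proof. by rewrite /l1; lia. Qed.

Lemma l1_triangle q p r : (l1 p r <= l1 p q + l1 q r)%N.
Proof. by rewrite /l1; lia. Qed.

Lemma depth_height p : (depth p <= height p)%N.
Proof. by rewrite /depth /height; have := valP p; lia. Qed.

Lemma depth_l1 p q : (depth p <= depth q + l1 p q)%N.
Proof. by rewrite /depth /l1; have := valP p; have := valP q; lia. Qed.

Lemma depth_ray a : (rayA R `|` rayB R) a -> depth a = 0%N.
Proof. by rewrite /depth; move=> [] [x x0 ->] /=; lia. Qed.

Lemma ray_near_depth p :
  exists2 a, (rayA R `|` rayB R) a & (l1 a p <= depth p)%N.
Proof.
case: p => -[x y] /= pP.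
have [x0|x0] := leP 0 x.
  have yP : (0 < (y, y).2) && (- (y, y).2 <= (y, y).1 <= (y, y).2)
    by rewrite /=; lia.
  exists (exist _ (y, y) yP); first by left; exists y => //; lia.
  by rewrite /l1 /depth /=; lia.
have yP : (0 < (- y, y).2) && (- (- y, y).2 <= (- y, y).1 <= (- y, y).2)
  by rewrite /=; lia.
exists (exist _ (- y, y) yP); first by right; exists y => //; lia.
by rewrite /l1 /depth /=; lia.
Qed.

(** Going up vertically by [n] from a point of the ray gives depth exactly [n]; the start [Y.+1]
    keeps the coordinate positive. *)
Lemma rayA_far n Y : exists a p,
  [/\ rayA R a, (l1 a p <= n)%N, (n <= depth p)%N,
      (Y <= height a)%N & (Y <= height p)%N].
Proof.
pose x : int := Y.+1.
have aP : (0 < (x, x).2) && (- (x, x).2 <= (x, x).1 <= (x, x).2)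
  by rewrite /=; lia.
have pP : let p := (x, x + n%:Z) in (0 < p.2) && (- p.2 <= p.1 <= p.2)
  by rewrite /=; lia.
exists (exist _ (x, x) aP), (exist _ (x, x + n%:Z) pP).
split; rewrite /l1 /depth /height /=; try lia.
by exists x => //; lia.
Qed.

Lemma rayB_far n Y : exists a p,
  [/\ rayB R a, (l1 a p <= n)%N, (n <= depth p)%N,
      (Y <= height a)%N & (Y <= height p)%N].
Proof.
pose x : int := Y.+1.
have aP : (0 < (- x, x).2) && (- (- x, x).2 <= (- x, x).1 <= (- x, x).2)
  by rewrite /=; lia.
have pP : let p := (- x, x + n%:Z) in (0 < p.2) && (- p.2 <= p.1 <= p.2)
  by rewrite /=; lia.
exists (exist _ (- x, x) aP), (exist _ (- x, x + n%:Z) pP).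
split; rewrite /l1 /depth /height /=; try lia.
by exists x => //; lia.
Qed.

Lemma rayAB_height a b : rayA R a -> rayB R b -> (height b <= l1 a b)%N.
Proof. by move=> [x x0 xE] [y y0 yE]; rewrite /height /l1 xE yE /=; lia. Qed.

Lemma height_l1 p q : (l1 p q <= (height p + height q).*2)%N.
Proof. by rewrite /height /l1; have := valP p; have := valP q; lia. Qed.

Lemma height_le_l1 p q : (height p <= height q + l1 p q)%N.
Proof. by rewrite /height /l1; lia. Qed.

(** The ball lies in a square of side [2r+1], whose points outside the cone are discarded by
    [insub]. *)
Lemma l1_ball_list r : exists m (l : cone R -> seq (cone R)), forall p,
  (size (l p) <= m)%N /\ [set q | (l1 p q <= r)%N] `<=` [set` l p].
Proof.
pose I := iota 0 (r.*2).+1.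
pose g p (i j : nat) : int * int :=
  ((val p).1 + i%:Z - r%:Z, (val p).2 + j%:Z - r%:Z).
exists (size I * size I)%N.
exists (fun p => pmap insub [seq g p i j | i <- I, j <- I]).
move=> p; split.
  by rewrite size_pmap (leq_trans (count_size _ _))// size_allpairs.
move=> q; rewrite /mkset => pq; rewrite mem_pmap.
apply/mapP; exists (val q); last by rewrite valK.
apply/allpairsP.
exists (`|((val q).1 - (val p).1 + r%:Z)%R|%N,
        `|((val q).2 - (val p).2 + r%:Z)%R|%N).
move: pq; rewrite /l1 /g; case: (val q) (val p) => [a b] [c d] /= pq.
by split; rewrite /= ?mem_iota; try lia; congr (_, _); lia.
Qed.

(** * Uniformly bounded families described by widths *)

Definition width_le (s : nat) (B : set (cone R)) :=
  forall p q, B p -> B q -> (l1 p q <= s)%N.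

Lemma metric_lsP U :
  metric_ls U <-> exists s, forall B, U B -> width_le s B.
Proof.
split=> [[r r0 rU] | [s sU]].
  exists (Num.truncn (r + r)).+1 => B /rU[x xB] p q /xB xp /xB xq.
  have {}xp : (l1 x p)%:R < r.
    by rewrite -mdist_l1; move: xp; rewrite ballEmdist.
  have {}xq : (l1 x q)%:R < r.
    by rewrite -mdist_l1; move: xq; rewrite ballEmdist.
  rewrite -(ler_nat R); apply: le_trans (ltW (truncnS_gt _)).
  have := l1_triangle x p q.
  rewrite -(ler_nat R) (l1C p x) natrD => /le_trans; apply.
  by apply/ltW/ltrD.
exists s.+1%:R => // B UB.
have [[x Bx]|nB] := pselect (B !=set0).
  exists x => p Bp; rewrite ballEmdist /= mdist_l1 ltr_nat ltnS.
  exact: sU UB _ _ Bx Bp.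
(* An empty [B] still has to lie in a ball, so some point of the cone is needed as centre. *)
have [a _] := rayA_far 0 0.
by exists a => p Bp; case: nB; exists p.
Qed.

(** The largest metric family at scale [s]. It contains all pairs at distance at most [s], and these
    are the test sets used below. *)
Definition narrow (s : nat) : set (set (cone R)) := [set B | width_le s B].

Lemma narrow_metric s : metric_ls (narrow s).
Proof. by apply/metric_lsP; exists s. Qed.

Lemma narrow_set2 s p q : (l1 p q <= s)%N -> narrow s [set p; q].
Proof. by move=> pq x y [] -> [] ->; rewrite ?l1xx// l1C. Qed.

Lemma narrow_cover s : is_cover (narrow s).
Proof.
apply/seteqP; split=> // p _; exists [set p; p]; last by left.
by apply: narrow_set2; rewrite l1xx.
Qed.

Lemma star_narrow (A : set (cone R)) s a p :
  A a -> (l1 a p <= s)%N -> star A (narrow s) p.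
Proof.
move=> Aa ap; exists [set a; p]; last by right.
by split; [exact: narrow_set2 | exists a; split => //; left].
Qed.

(** Stars of the two rays under metric families are cofinal with the strips of bounded depth, so the
    condition only concerns the members that meet such a strip. *)
Lemma cone_lsP U : cone_ls R U <-> uniformly_locally_finite U /\
  forall r, exists s, forall V p,
    U V -> V p -> (depth p <= r)%N -> width_le s V.
Proof.
split=> -[ulfU nearU]; split=> // r.
  have /metric_lsP[s sU] := nearU _ (narrow_metric r) (narrow_cover r).
  exists s => V p UV Vp pr; apply: sU; split => //; exists p; split => //.
  have [a ra /leq_trans ap] := ray_near_depth p.
  by apply: star_narrow ra _; exact: ap.
move=> /metric_lsP[t tr] _; have [s sU] := nearU t.
apply/metric_lsP; exists s => V [UV [p [Vp [W [rW [a [Wa aA]]] Wp]]]].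
apply: sU UV Vp _; rewrite (leq_trans (depth_l1 _ a))// (depth_ray aA).
exact: tr rW _ _ Wp Wa.
Qed.

Lemma metric_sub_cone_ls : @metric_ls R (cone R) `<=` cone_ls R.
Proof.
move=> U /metric_lsP[s sU]; apply/cone_lsP; split; last first.
  by move=> r; exists s => V p UV _ _; exact: sU.
have [m [l lball]] := l1_ball_list s; apply/ulfP; exists m, l => p.
have [lm lp] := lball p; split=> // q /star1P[V [UV Vp Vq]].
by apply: lp; exact: sU UV _ _ Vp Vq.
Qed.

Lemma cone_ls_ulf : ls_uniformly_locally_finite (cone_ls R).
Proof. by move=> U []. Qed.

Lemma cone_ls_structure : ls_structure (cone_ls R).
Proof.
split.
- by exists (narrow 0); exact/metric_sub_cone_ls/narrow_metric.
- move=> F1 F2 /cone_lsP[ulfF sF] F21.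
  have F2P B : F2 B ->
      (exists2 C, F1 C & B `<=` C) \/ forall x y, B x -> B y -> x = y.
    move=> /F21 BC.
    have [/BC|nxy] := pselect (exists x y, [/\ B x, B y & x <> y]).
      by left.
    by right=> x y Bx By; apply: contrapT => xy; apply: nxy; exists x, y.
  apply/cone_lsP; split; first exact: ulf_refine F2P.
  move=> r; have [s rs] := sF r; exists s => B p /F2P[[C FC BC]|Bs] Bp pr.
    by move=> x y /BC Cx /BC Cy; exact: rs FC (BC _ Bp) pr _ _ Cx Cy.
  by move=> x y Bx By; rewrite (Bs _ _ Bx By) l1xx.
- move=> F1 F2 /cone_lsP[ulf1 sF1] /cone_lsP[ulf2 sF2].
  apply/cone_lsP; split; first exact: ulf_star.
  (* If [star B F2] meets depth at most [r], then some [b] in [B] has depth at most [r + s2], and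
     all of [B] has depth at most [r + s2 + s1]. Thus every element of [F2] that meets [B] has width
     at most [s3]. *)
  move=> r; have [s2 s2F] := sF2 r.
  have [s1 s1F] := sF1 (r + s2)%N.
  have [s3 s3F] := sF2 (r + s2 + s1)%N.
  exists (s3 + s1 + s3)%N => _ p [B FB <-] [V [FV [b [Vb Bb]]] Vp] pr.
  have bs : (depth b <= r + s2)%N.
    by rewrite (leq_trans (depth_l1 b p))// leq_add// (s2F _ _ FV Vp pr).
  have Bs := s1F _ _ FB Bb bs.
  have near c W : B c -> F2 W -> W c -> width_le s3 W.
    move=> Bc FW Wc; apply: s3F FW Wc _.
    by rewrite (leq_trans (depth_l1 c b))// leq_add// Bs.
  move=> x y [W [FW [c [Wc Bc]]] Wx] [W' [FW' [c' [Wc' Bc']]] Wy].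
  rewrite (leq_trans (l1_triangle c' x y))// leq_add ?(near c' W')//.
  by rewrite (leq_trans (l1_triangle c x c'))// leq_add ?(near c W) ?Bs.
Qed.

(** * Weakly bounded sets and coarse separation *)

Lemma width_ls_bounded s B : width_le s B -> ls_bounded (cone_ls R) B.
Proof.
move=> sB; exists (narrow s).
by split; [exact/metric_sub_cone_ls/narrow_metric | exact: narrow_cover |].
Qed.

Lemma coarse_componentT p : coarse_component (cone_ls R) p = [set: cone R].
Proof.
apply/seteqP; split=> // q _; exists [set p; q]; last by right.
split; last by left.
by apply: (@width_ls_bounded (l1 p q)); exact: narrow_set2.
Qed.

(** There is a single coarse component. A bounded set lies in the star of any of its points, which
    is finite by local finiteness; conversely, bounded height bounds the width. *)
Lemma weakly_boundedP K : weakly_bounded (cone_ls R) K <->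
  exists Y, forall p, K p -> (height p < Y)%N.
Proof.
split=> [Kb|[Y KY] p].
  have [p0 _] := rayA_far 0 0.
  have [U [[ulfU _] _]] := Kb p0; rewrite coarse_componentT setIT => UK.
  have [[k Kk]|nK] := pselect (K !=set0); last first.
    by exists 0%N => p Kp; case: nK; exists p.
  have /ulfP[m [l lU]] := ulfU.
  exists (\max_(q <- l k) height q).+1 => p Kp; rewrite ltnS.
  apply: (leq_bigmax_seq (F := height)) => //.
  by apply: (lU k).2; apply/star1P; exists K.
rewrite coarse_componentT setIT; apply: (@width_ls_bounded (Y + Y).*2).
move=> q r /KY qY /KY rY; apply: leq_trans (height_l1 _ _) _.
by rewrite leq_double leq_add// ltnW.
Qed.

(** Members of [U] meeting a ray have a common width [s]. A point of both stars is then within [s]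
    of some [a] and some [b] on the two rays, and the height of [b] is at most the distance from [a]
    to [b], hence at most [2s]. *)
Lemma cone_coarsely_separated :
  coarsely_separated (cone_ls R) (rayA R) (rayB R).
Proof.
move=> U /cone_lsP[_ /(_ 0)[s sU]]; apply/weakly_boundedP.
exists (s + s + s).+1 => p [[V [UV [a [Va ra]]] Vp] [W [UW [b [Wb rb]]] Wp]].
have ap : (l1 a p <= s)%N.
  by apply: (sU V a) => //; rewrite depth_ray//; left.
have pb : (l1 p b <= s)%N.
  by apply: (sU W b) => //; rewrite depth_ray//; right.
rewrite ltnS (leq_trans (height_le_l1 p b))// leq_add//.
rewrite (leq_trans (rayAB_height ra rb))//.
by rewrite (leq_trans (l1_triangle p _ _))// leq_add.
Qed.

(** * Deep sets and matchings between them *)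

Definition deep (P : set (cone R)) :=
  forall n, exists2 p, P p & (n <= depth p)%N.

Lemma deep_pairs P Q : deep P -> deep Q ->
  exists U, [/\ cone_ls R U, is_cover U &
    forall Y, exists p q, [/\ P p, Q q, U [set p; q],
      (Y <= height p)%N & (Y <= height q)%N]].
Proof.
move=> dP dQ.
have /choice[p_ pP] n : exists p, P p /\ (n <= depth p)%N.
  by have [p] := dP n; exists p.
have /choice[q_ qQ] n : exists q, Q q /\ (n <= depth q)%N.
  by have [q] := dQ n; exists q.
(* The next threshold exceeds the depths of both points of the current pair, so the following pair
   lies strictly deeper. *)
pose next n := (maxn (depth (p_ n)) (depth (q_ n))).+1.
pose t k := iter k next 0%N.
pose p k := p_ (t k); pose q k := q_ (t k).
have tS k : (t k < t k.+1)%N.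
  by rewrite ltnS leq_max (pP (t k)).2.
have tk k : (k <= t k)%N by elim: k => // k /leq_ltn_trans/(_ (tS k)).
have tmono k l : (t k < t l)%N -> (k < l)%N.
  apply: contraTT; rewrite -!leqNgt.
  exact: homo_leq leqnn leq_trans (fun i => ltnW (tS i)) _ _.
(* The k-th pair lies in its own range of depths, so the pairs are disjoint. *)
have band k x : [set p k; q k] x -> (t k <= depth x < t k.+1)%N.
  move=> [] ->; rewrite ltnS leq_max leqnn ?orbT andbT.
    exact: (pP (t k)).2.
  exact: (qQ (t k)).2.
have band_inj k l x : [set p k; q k] x -> [set p l; q l] x -> k = l.
  move=> /band/andP[k1 k2] /band/andP[l1 l2].
  have := tmono _ _ (leq_ltn_trans k1 l2).
  by have := tmono _ _ (leq_ltn_trans l1 k2); lia.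
(* The singletons make the matching a cover. *)
pose U := [set V | (exists k, V = [set p k; q k]) \/ (exists x, V = [set x])].
exists U; split; last first.
- move=> Y; exists (p Y), (q Y); split.
  + exact: (pP _).1.
  + exact: (qQ _).1.
  + by left; exists Y.
  + by rewrite (leq_trans (tk Y))// (leq_trans (pP (t Y)).2)// depth_height.
  + by rewrite (leq_trans (tk Y))// (leq_trans (qQ (t Y)).2)// depth_height.
- by apply/seteqP; split=> // x _; exists [set x] => //; right; exists x.
apply/cone_lsP; split; last first.
  (* A pair meeting depth at most [r] has index [k <= t k <= r], so a maximum over finitely many
     pairs suffices. *)
  move=> r; exists (\max_(k < r.+1) l1 (p k) (q k)) => V x.
  move=> [[k ->]|[y ->]] Vx xr; last by move=> a b -> ->; rewrite l1xx.
  apply: narrow_set2.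
  have kr : (k < r.+1)%N.
    have /andP[kx _] := band _ _ Vx.
    by rewrite ltnS (leq_trans (tk k))// (leq_trans kx).
  exact: (leq_bigmax (F := fun k : 'I_r.+1 => l1 (p k) (q k)) (Ordinal kr)).
(* The star of [x] contains at most [x] and the two points of the one pair through it. *)
apply/ulfP; exists 3.
suff /choice[l lU] x : exists l : seq (cone R),
  (size l <= 3)%N /\ star [set x] U `<=` [set` l] by exists l.
have [[k kx]|nk] := pselect (exists k, [set p k; q k] x).
  exists [:: x; p k; q k]; split => // y /star1P[V [[[l ->]|[z ->]] Vx Vy]].
    rewrite (band_inj _ _ _ kx Vx); case: Vy => ->.
      by rewrite /mkset !inE eqxx orbT.
    by rewrite /mkset !inE eqxx !orbT.
  by move: Vy Vx => /= -> ->; rewrite !inE eqxx.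
exists [:: x]; split => // y /star1P[V [[[l ->]|[z ->]] Vx Vy]].
  by case: nk; exists l.
by move: Vy Vx => /= -> ->; rewrite !inE eqxx.
Qed.

(** Both heights are bounded below to serve two uses: slow oscillation needs both points outside a
    weakly bounded set, while a coarse neighbourhood constrains one of them. *)
Definition eventually_near (A P : set (cone R)) := forall n, exists Y,
  forall a p, A a -> (l1 a p <= n)%N ->
    (Y <= height a)%N -> (Y <= height p)%N -> P p.

Lemma deep_rayA P : eventually_near (rayA R) P -> deep P.
Proof.
move=> Pn n; have [Y PY] := Pn n; have [a [p [ra ap np aY pY]]] := rayA_far n Y.
by exists p => //; exact: PY ra ap aY pY.
Qed.

Lemma deep_rayB P : eventually_near (rayB R) P -> deep P.
Proof.
move=> Pn n; have [Y PY] := Pn n; have [a [p [ra ap np aY pY]]] := rayB_far n Y.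
by exists p => //; exact: PY ra ap aY pY.
Qed.

(** * Slowly oscillating functions *)

Lemma slowly_oscillating_near (f : cone R -> R^o) U e :
  slowly_oscillating (cone_ls R) f -> cone_ls R U -> 0 < e ->
  exists Y, forall p q,
    U [set p; q] -> (Y <= height p)%N -> (Y <= height q)%N ->
    `|f p - f q| < e.
Proof.
move=> fso UL e0; have [K /weakly_boundedP[Y KY] Kf] := fso U e UL e0.
exists Y => p q Upq pY qY.
have pqK : [set p; q] `&` K = set0.
  by apply/seteqP; split=> // x [] /= [] -> /KY; rewrite ltnNge ?pY ?qY.
rewrite -lte_fin; apply: le_lt_trans (Kf _ Upq pqK).
rewrite distrC; apply: ereal_sup_ubound; right.
exists (f p); first by exists p => //; left.
by exists (f q) => //; exists q => //; right.
Qed.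

Lemma not_slowly_oscillating_separated : ~ (exists f : cone R -> R^o,
  [/\ forall p, 0 <= f p <= 1, slowly_oscillating (cone_ls R) f,
      f @` rayA R = [set 0] & f @` rayB R = [set 1]]).
Proof.
move=> [f [_ fso fA fB]].
have f0 a : rayA R a -> f a = 0.
  by move=> ra; have : (f @` rayA R) (f a) by [exists a]; rewrite fA.
have f1 b : rayB R b -> f b = 1.
  by move=> rb; have : (f @` rayB R) (f b) by [exists b]; rewrite fB.
(* Values below 1/4 and above 3/4 differ by more than 1/2, against an oscillation below 1/4 along
   the matching. *)
have quarter : 0 < 4^-1 :> R by rewrite invr_gt0.
have near n := slowly_oscillating_near fso
  (metric_sub_cone_ls (narrow_metric n)) quarter.
have dP : deep [set p | f p < 4^-1].
  apply: deep_rayA => n; have [Y fY] := near n; exists Y => a p ra ap aY pY.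
  have := fY _ _ (narrow_set2 ap) aY pY; rewrite f0// sub0r normrN.
  exact: le_lt_trans (ler_norm _).
have dQ : deep [set p | 1 - 4^-1 < f p].
  apply: deep_rayB => n; have [Y fY] := near n; exists Y => a p ra ap aY pY.
  have := fY _ _ (narrow_set2 ap) aY pY; rewrite f1// => fp.
  by rewrite /= ltrBlDr -ltrBlDl (le_lt_trans (ler_norm _)).
have [U [UL _ Upq]] := deep_pairs dP dQ.
have [Y fY] := slowly_oscillating_near fso UL quarter.
have [p [q [/= fp fq pqU pY qY]]] := Upq Y.
have := fY _ _ pqU pY qY; rewrite ltr_norml => /andP[fpq _].
by move: fp fq fpq; move: (f p : R) (f q : R) => x y; clear; lra.
Qed.

(** * Failure of hls-normality *)

Lemma rayA_coarse_neighbourhood :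
  coarse_neighbourhood (cone_ls R) (rayA R) (~` rayB R).
Proof.
split=> [a [x x0 xE] [y y0 yE]|U UL Ucov].
  by move: xE; rewrite yE => -[]; lia.
(* As [U] is a cover, a point of [rayB] lies in its own star; the exceptional points therefore lie
   in both stars, which coarse separation controls. *)
exists (star (rayA R) U `&` star (rayB R) U).
  exact: cone_coarsely_separated.
move=> p Ap; have [rb|] := pselect (rayB R p); last by left.
right; split=> //; have : [set: cone R] p by [].
by rewrite -Ucov => -[V UV Vp]; exists V => //; split => //; exists p.
Qed.

Lemma coarse_neighbourhood_near A N U : coarse_neighbourhood (cone_ls R) A N ->
  cone_ls R U -> is_cover U -> exists Y, forall p q, U [set p; q] ->
    A p -> (Y <= height q)%N -> N q.
Proof.
move=> [_ AN] UL Ucov; have [K /weakly_boundedP[Y KY] AK] := AN U UL Ucov.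
exists Y => p q Upq Ap qY.
have /AK[//|/KY] : star A U q; last by rewrite ltnNge qY.
exists [set p; q]; last by right.
by split=> //; exists p; split=> //; left.
Qed.

Lemma not_hls_normal : ~ hls_normal_discrete (cone_ls R).
Proof.
move=> normal.
have [V [AV VB]] := normal _ _ rayA_coarse_neighbourhood.
have [W [VW WB]] := normal _ _ VB.
have near A N n (AN : coarse_neighbourhood (cone_ls R) A N) :=
  coarse_neighbourhood_near AN
    (metric_sub_cone_ls (narrow_metric n)) (narrow_cover n).
have dV : deep V.
  apply: deep_rayA => n; have [Y nY] := near _ _ n AV.
  by exists Y => a p ra ap _; exact: nY (narrow_set2 ap) ra.
have dW : deep (~` W).
  apply: deep_rayB => n; have [Y nY] := near _ _ n WB.
  (* The pair is read backwards: a point of [W] close to a high [b] would force [b] out of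
     [rayB]. *)
  exists Y => b p rb bp bY _ Wp; apply: (nY p b) rb => //.
  by apply: narrow_set2; rewrite l1C.
have [U [UL Ucov Upq]] := deep_pairs dV dW.
have [Y nY] := coarse_neighbourhood_near VW UL Ucov.
have [p [q [Vp nWq pqU _ qY]]] := Upq Y.
exact/nWq/(nY _ _ pqU Vp qY).
Qed.

End Cone.

Theorem proposition7p1 (R : realType) :
  [/\ [/\ ls_structure (cone_ls R),
          ls_uniformly_locally_finite (cone_ls R)
        & @metric_ls R (cone R) `<=` cone_ls R],
      coarsely_separated (cone_ls R) (rayA R) (rayB R),
      ~ (exists f : cone R -> R^o,
           [/\ forall p, 0 <= f p <= 1,
               slowly_oscillating (cone_ls R) f,
               f @` rayA R = [set 0]
             & f @` rayB R = [set 1]])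
    & ~ hls_normal_discrete (cone_ls R)].
Proof.
split; first split.
- exact: cone_ls_structure.
- exact: cone_ls_ulf.
- exact: metric_sub_cone_ls.
- exact: cone_coarsely_separated.
- exact: not_slowly_oscillating_separated.
- exact: not_hls_normal.
Qed.
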